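(* For every integer $k\ge 1$ $$F_{k}=\frac{1}{2^{k-1}}\sum_{s=0}^{\lfloor\frac{k-1}{2}\rfloor}\sum_{m=0}^{k-2s-1}\binom{k-s-m-1}{s}\binom{m+s}{m}5^s.$$
   Context: $\{F_k\}_{k\ge 0}$ is the Fibonacci sequence: $F_0=0$, $F_1=1$, $F_{k+1}=F_k+F_{k-1}$ for $k\ge 1$. *)

(* Defs.v *)
From mathcomp Require Import all_boot all_order all_algebra.

Set Implicit Arguments.
Unset Strict Implicit.
Unset Printing Implicit Defensive.

Fixpoint fib (n : nat) : nat :=
  match n with
  | 0 => 0
  | n1.+1 => if n1 is n2.+1 then fib n1 + fib n2 else 1
  end.

(* Main.v *)
Require Import Defs.
From mathcomp Require Import all_boot all_order all_algebra.
From mathcomp Require Import zify.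
Import GRing.Theory.
Local Open Scope ring_scope.

(** Put n = k - 1.  With i = m + s the inner sum runs over the products
    'C(n - i, s) * 'C(i, s), and the Vandermonde-type convolution
    [sum_bin_mul_bin] (choose 2s + 1 of n + 1 points by first choosing the
    middle one) collapses it to 'C(k, 2s + 1).  What remains is Catalan's
    formula 2 ^ (k - 1) * F_k = sum over s of 'C(k, 2s + 1) * 5 ^ s
    ([fib_odd_bin_sum]), which is Binet's formula expanded by the binomial
    theorem: writing (1 + sqrt 5) ^ k = b_k + a_k * sqrt 5, the integers a_k are
    these sums of odd-indexed binomials, b_k are the even-indexed ones, and
    multiplication by 1 + sqrt 5 gives a_(k+1) = a_k + b_k and
    b_(k+1) = b_k + 5 * a_k, so that a_k satisfies the Fibonacci recurrence
    rescaled by 2 ^ k.  Everything takes place in the natural numbers, with no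
    square root, until the final division by 2 ^ (k - 1). *)

(** Sort the (p + q + 1)-subsets of {0, ..., n} by their element i of rank p:
    p elements lie among the i smaller points, q among the n - i larger ones.
    The proof is by Pascal's rule in the second factor. *)
Lemma sum_bin_mul_bin (n p q : nat) :
  (\sum_(0 <= i < n.+1) 'C(i, p) * 'C(n - i, q) = 'C(n.+1, (p + q).+1))%N.
Proof.
elim: n q => [|n IHn] q.
  by case: p q => [|p] [|q]; rewrite big_nat1 ?bin0 ?bin0n ?muln0 ?mul0n // bin_small //; lia.
rewrite big_nat_recr //= subnn; case: q => [|q].
  (* For q = 0 this is the hockey-stick identity. *)
  rewrite addn0 bin0 muln1 binS -[p in 'C(n.+1, p.+1)]addn0 -IHn; congr (_ + _)%N.
  by apply: eq_bigr => i _; rewrite !bin0.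
rewrite bin0n muln0 addn0 addnS binS -{1}addnS -!IHn -big_split.
by apply: eq_big_nat => i /andP[_ le_in]; rewrite subSn // binS mulnDr.
Qed.

Lemma sum_bin_convolution (n s : nat) : (2 * s <= n)%N ->
  (\sum_(0 <= m < (n - 2 * s).+1) 'C(n - s - m, s) * 'C(m + s, m)
   = 'C(n.+1, (2 * s).+1))%N.
Proof.
move=> le_2s_n; rewrite mul2n -addnn -sum_bin_mul_bin.
(* Indices i < s and i > n - s contribute zero. *)
have lo0 : (\sum_(0 <= i < s) 'C(i, s) * 'C(n - i, s) = 0)%N.
  by rewrite big_nat big1 // => i /andP[_ lt_is]; rewrite bin_small.
have hi0 : (\sum_((n - s).+1 <= i < n.+1) 'C(i, s) * 'C(n - i, s) = 0)%N.
  rewrite big_nat big1 // => i /andP[lt_i le_in].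
  by rewrite ['C(n - i, s)]bin_small ?muln0 //; lia.
rewrite [RHS](big_cat_nat _ (n := s)) /=; [|lia|lia].
rewrite lo0 add0n [RHS](big_cat_nat _ (n := (n - s).+1)) /=; [|lia|lia].
rewrite hi0 addn0 [RHS](big_addn 0).
have -> : ((n - s).+1 - s = (n - (s + s)).+1)%N by lia.
apply: eq_big_nat => m _.
rewrite mulnC -bin_sub ?leq_addr // addKn; congr (_ * 'C(_, _))%N; lia.
Qed.

(** The coefficient of sqrt 5 in (1 + sqrt 5) ^ k once k <= 2 * N.  The cut-off
    N does not depend on k, so that sums for consecutive k have the same range
    and can be compared term by term. *)
Definition odd_bin_sum (N k : nat) : nat :=
  (\sum_(0 <= s < N) 'C(k, (2 * s).+1) * 5 ^ s)%N.

(** Likewise the coefficient of 1, once k < 2 * N. *)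
Definition even_bin_sum (N k : nat) : nat :=
  (\sum_(0 <= s < N) 'C(k, 2 * s) * 5 ^ s)%N.

Lemma odd_bin_sumS (N k : nat) :
  odd_bin_sum N k.+1 = (odd_bin_sum N k + even_bin_sum N k)%N.
Proof.
by rewrite -big_split; apply: eq_bigr => s _; rewrite binS mulnDl.
Qed.

(** Shifting s by one sends the odd-indexed sum to the even-indexed one; the
    bound on k makes the top term lost in the shift vanish. *)
Lemma even_bin_sumS (N k : nat) : (k.+1 < 2 * N)%N ->
  even_bin_sum N k.+1 = (even_bin_sum N k + 5 * odd_bin_sum N k)%N.
Proof.
case: N => [|N] lt_k; first by lia.
rewrite /odd_bin_sum big_nat_recr //= bin_small ?mul0n ?addn0; last by lia.
rewrite /even_bin_sum !(big_nat_recl N) // !muln0 !bin0 -addnA; congr (_ + _)%N.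
rewrite big_distrr -big_split; apply: eq_bigr => s _ /=.
have -> : (2 * s.+1 = (2 * s).+2)%N by lia.
by rewrite binS expnS; lia.
Qed.

(** Catalan's formula, doubled so that it also holds at k = 0.  The recurrences
    give a_(k+2) = 2 * a_(k+1) + 4 * a_k, which 2 ^ k * fib k satisfies too; the
    bound on k ensures that no nonzero term is cut off. *)
Lemma fib_odd_bin_sum (N k : nat) : (k <= 2 * N)%N ->
  (2 * odd_bin_sum N k = 2 ^ k * fib k)%N.
Proof.
have [m] := ubnP k; elim: m k => // m IHm [|[|k]] lt_km le_kN.
- by rewrite /odd_bin_sum big1.
- case: N {IHm} le_kN => // N _.
  by rewrite /odd_bin_sum big_nat_recl // big1 // => s _; rewrite bin_small //; lia.
have IH0 := IHm k ltac:(lia) ltac:(lia).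
have := IHm k.+1 ltac:(lia) ltac:(lia).
rewrite -[fib k.+2]/(fib k.+1 + fib k)%N.
rewrite odd_bin_sumS (odd_bin_sumS N k.+1) odd_bin_sumS even_bin_sumS //.
rewrite !expnS; lia.
Qed.

Theorem corollary4p10 (k : nat) (k_ge1 : (1 <= k)%N) :
  (fib k)%:R =
    1 / 2 ^+ (k - 1)
    * \sum_(0 <= s < ((k - 1) %/ 2).+1)
        \sum_(0 <= m < (k - 2 * s - 1).+1)
          'C(k - s - m - 1, s)%:R * 'C(m + s, m)%:R * 5 ^+ s :> rat.
Proof.
case: k k_ge1 => // n _; rewrite subn1 succnK.
have two_neq0 : 2 ^+ n != 0 :> rat by rewrite expf_neq0.
apply: (mulfI two_neq0); rewrite mulrA mul1r divff // mul1r.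
set N := (n %/ 2).+1.
transitivity ((odd_bin_sum N n.+1)%:R : rat).
  have le_nN : (n.+1 <= 2 * N)%N by rewrite /N; lia.
  rewrite -natrX -natrM; congr (_%:R); have := fib_odd_bin_sum N n.+1 le_nN.
  by move=> /eqP; rewrite expnS -mulnA eqn_pmul2l // => /eqP ->.
rewrite /odd_bin_sum natr_sum; apply: eq_big_nat => s /andP[_ lt_sN].
rewrite -sum_bin_convolution; last by rewrite /N in lt_sN; lia.
rewrite natrM natrX natr_sum mulr_suml.
have -> : (n.+1 - 2 * s - 1 = n - 2 * s)%N by lia.
apply: eq_bigr => m _; rewrite natrM; congr (_%:R * _%:R * _).
by congr 'C(_, _); lia.
Qed.
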